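(* Let $T$ be a linear operator from a Hilbert space $\mathfrak H$ to a Hilbert space $\mathfrak K$, with domain $\operatorname{dom}T$ a linear subspace of $\mathfrak H$. Then $T$ is closable if and only if for all $\varphi\in\operatorname{dom}T$: $$\|T\varphi\|^2=\sup_{h\in\operatorname{dom}T}\ \inf_{g\in\operatorname{dom}T}\left\{\|g+h\|^2-\|\varphi+h\|^2+\|Tg\|^2\right\}.$$
   Context: Hilbert spaces are complex. The operator $T$ is not assumed to be bounded, closed or densely defined. $T$ is closable if the closure of its graph in $\mathfrak H\times\mathfrak K$ is the graph of an operator. *)

(* Defs.v *)
From HB Require Import structures.
From mathcomp Require Import all_boot all_order all_algebra.
From mathcomp Require Import all_classical all_reals all_analysis.
From mathcomp Require Import complex.

Set Implicit Arguments.
Unset Strict Implicit.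
Unset Printing Implicit Defensive.

Import Order.TTheory GRing.Theory Num.Theory.
Import numFieldNormedType.Exports.

Local Open Scope classical_set_scope.
Local Open Scope ring_scope.

(* The inner product is linear in its first argument and conjugate-linear in
   its second one. *)
HB.mixin Record NormedModule_isHilbert (R : realType) V
    of CompleteNormedModule R[i] V := {
  hdot : {dot V for Num.conj} ;
  hdotE : forall x : V, hdot x x = `|x| ^+ 2
}.

#[short(type="hilbertType")]
HB.structure Definition Hilbert (R : realType) :=
  {V of CompleteNormedModule R[i] V & NormedModule_isHilbert R V}.

(* On a normed module over R[i], `|x| is a nonnegative real element of R[i];
   hnorm x is the same number in R. *)
Definition hnorm (R : realType) (V : normedModType R[i]) (x : V) : R :=
  complex.Re `|x|.

(* A partial linear map is encoded by its domain and a total function, whose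
   values outside the domain are irrelevant. *)
Record linear_operator (R : realType) (H K : hilbertType R) := LinearOperator {
  dom : set H ;
  operator_fun :> H -> K ;
  dom_submod : submod_closed [in dom] ;
  operator_linear : forall (a : R[i]) (x y : H), dom x -> dom y ->
    operator_fun (a *: x + y) = a *: operator_fun x + operator_fun y
}.

Definition graph (R : realType) (H K : hilbertType R)
    (T : linear_operator H K) : set (H * K) :=
  [set (x, T x) | x in dom T].

Definition closable (R : realType) (H K : hilbertType R)
    (T : linear_operator H K) : Prop :=
  exists S : linear_operator H K, closure (graph T) = graph S.

(* Main.v *)
(* For z = T phi, let m_n be the infimum over u in dom T of
   (n+1) |u|^2 + |z - T u|^2.  The m_n increase and stay below |z|^2, so by the
   parallelogram law near minimizers u_n have T u_n Cauchy, while u_n -> 0;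
   closability forces T u_n -> 0.  First-order near optimality of u_n then says
   that h = - ((n+1) u_n + phi) nearly attains the supremum, which is always
   bounded by |T phi|^2 (take g = phi).  This avoids adjoints and orthogonal
   projections.
   Conversely, if (0, y) is in the closure of the graph, perturbing g = phi by
   small u with T u near y turns the formula into |T phi| <= |T phi - y|;
   choosing T phi near y gives y = 0. *)
Require Import Defs.
From mathcomp Require Import all_boot all_order all_algebra.
From mathcomp Require Import all_classical all_reals all_analysis.
From mathcomp Require Import complex.
From mathcomp Require Import ring lra.

Set Implicit Arguments.
Unset Strict Implicit.
Unset Printing Implicit Defensive.

Import Order.TTheory GRing.Theory Num.Theory.
Import numFieldNormedType.Exports.

Local Open Scope classical_set_scope.
Local Open Scope ring_scope.

(** * Real-valued norms *)

Lemma normr_hnorm {R : realType} {V : normedModType R[i]} (x : V) :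
  `|x| = (hnorm x)%:C%C.
Proof. by rewrite /hnorm RRe_real ?ger0_real. Qed.

Lemma hnorm_ge0 {R : realType} {V : normedModType R[i]} (x : V) : 0 <= hnorm x.
Proof. by rewrite -lecR -normr_hnorm normr_ge0. Qed.

Lemma hnorm0_eq0 {R : realType} {V : normedModType R[i]} (x : V) :
  hnorm x = 0 -> x = 0.
Proof. by move=> x0; apply/normr0_eq0; rewrite normr_hnorm x0. Qed.

Lemma hnormr0 {R : realType} {V : normedModType R[i]} : hnorm (0 : V) = 0.
Proof. by rewrite /hnorm normr0. Qed.

Lemma ler_hnormD {R : realType} {V : normedModType R[i]} (x y : V) :
  hnorm (x + y) <= hnorm x + hnorm y.
Proof. by rewrite -lecR rmorphD /= -!normr_hnorm ler_normD. Qed.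

Lemma hnormrN {R : realType} {V : normedModType R[i]} (x : V) :
  hnorm (- x) = hnorm x.
Proof. by rewrite /hnorm normrN. Qed.

Lemma hnormrZ {R : realType} {V : normedModType R[i]} (a : R[i]) (x : V) :
  hnorm (a *: x) = complex.Re `|a| * hnorm x.
Proof.
rewrite {1}/hnorm normrZ (normr_hnorm x).
by rewrite -(RRe_real (normr_real a)) -rmorphM.
Qed.

(** * The underlying real inner product *)

Section InnerProduct.
Context {R : realType} {V : hilbertType R}.
Implicit Types (x y z : V) (t : R).

(** Taking real parts gives a symmetric real-bilinear form. Squared norms then expand, by
    [-!ipxx !ipE !ipxx], into real squares and cross terms that [lra] can treat as atoms. *)
Definition ip x y : R := complex.Re (hdot x y).

Lemma ipC x y : ip x y = ip y x.
Proof. by rewrite /ip hermC /= expr0 mul1r; case: (hdot y x). Qed.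

Lemma ipDl x y z : ip (x + y) z = ip x z + ip y z.
Proof. by rewrite /ip linearDl raddfD. Qed.

Lemma ipNl x z : ip (- x) z = - ip x z.
Proof. by rewrite /ip linearNl raddfN. Qed.

Lemma ipZl t x z : ip (t%:C%C *: x) z = t * ip x z.
Proof.
rewrite /ip linearZl_LR /=.
by case: (hdot x z) => a b; rewrite /= mul0r subr0.
Qed.

Lemma ipxx x : ip x x = hnorm x ^+ 2.
Proof. by rewrite /ip hdotE normr_hnorm -rmorphXn. Qed.

Lemma ipDr x y z : ip z (x + y) = ip z x + ip z y.
Proof. by rewrite !(ipC z) ipDl. Qed.

Lemma ipNr x z : ip z (- x) = - ip z x.
Proof. by rewrite !(ipC z) ipNl. Qed.

Lemma ipZr t x z : ip z (t%:C%C *: x) = t * ip z x.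
Proof. by rewrite !(ipC z) ipZl. Qed.

End InnerProduct.

Definition ipE := (@ipDl, @ipDr, @ipNl, @ipNr, @ipZl, @ipZr).

(** * Neighbourhoods, graph closure and completeness with real radii *)

Lemma nbhs_hnormP {R : realType} {V : normedModType R[i]} (x : V) (A : set V) :
  nbhs x A <->
  exists2 e : R, 0 < e & forall y, hnorm (y - x) < e -> A y.
Proof.
split=> [/nbhs_ballP[e /= e0 eA]|[e e0 eA]].
  (* A positive element of [R[i]] is real, so complex radii reduce to real ones. *)
  have eE : e = (complex.Re e)%:C%C by rewrite RRe_real // gtr0_real.
  exists (complex.Re e) => [|y yx]; first by rewrite -ltcR -eE.
  by apply: eA; rewrite -ball_normE /= distrC normr_hnorm eE ltcR.
apply/nbhs_ballP; exists e%:C%C; rewrite /= ?ltcR// => y.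
by rewrite -ball_normE /= distrC normr_hnorm ltcR => /eA.
Qed.

Lemma closure_graphP {R : realType} {H K : hilbertType R}
    (T : linear_operator H K) (x : H) (y : K) :
  closure (graph T) (x, y) <->
  forall e : R, 0 < e ->
    exists g, [/\ dom T g, hnorm (g - x) < e & hnorm (T g - y) < e].
Proof.
split=> [cxy e e0|xyP B].
  have : nbhs (x, y)
      ([set u | hnorm (u - x) < e] `*` [set u | hnorm (u - y) < e]).
    by exists ([set u | hnorm (u - x) < e], [set u | hnorm (u - y) < e]);
      [split; apply/nbhs_hnormP; exists e|].
  by move/cxy => [[a b] [[g Tg [<- <-]] [/= gx gy]]]; exists g.
case=> -[A A'] [/= /nbhs_hnormP[e e0 eA] /nbhs_hnormP[e' e'0 eA'] AB].
have [|g [Tg gx gy]] := xyP (Num.min e e'); first by rewrite lt_min e0.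
exists (g, T g); split; first by exists g.
by move: gx gy; rewrite !lt_min => /andP[gx _] /andP[_ gy]; apply: AB;
  split; [apply: eA|apply: eA'].
Qed.

Lemma hnorm_cauchy_cvg {R : realType} {V : completeNormedModType R[i]}
    (v : nat -> V) :
  (forall e : R, 0 < e -> exists N, forall n p : nat,
     (N <= n)%N -> (n <= p)%N -> hnorm (v p - v n) < e) ->
  exists y, forall e : R, 0 < e -> exists N, forall n, (N <= n)%N ->
    hnorm (v n - y) < e.
Proof.
move=> vC; have /cauchy_cvg vcvg : cauchy (v n @[n --> \oo]).
  apply: cauchy_exP => e e0.
  have eE : e = (complex.Re e)%:C%C by rewrite RRe_real // gtr0_real.
  have [|N vN] := vC (complex.Re e); first by rewrite -ltcR -eE.
  exists (v N), N => //= n Nn.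
  by rewrite -ball_normE /= distrC normr_hnorm eE ltcR vN.
exists (lim (v n @[n --> \oo])) => e e0.
have : nbhs (lim (v n @[n --> \oo]))
    [set y | hnorm (y - lim (v n @[n --> \oo])) < e].
  by apply/nbhs_hnormP; exists e.
by move/vcvg => [N _ vN]; exists N => n /vN.
Qed.

(** * Partial operators and closability *)

Section OperatorTheory.
Context {R : realType} {H K : hilbertType R}.
Implicit Types (T : linear_operator H K) (x g u v w : H) (y z : K).

Lemma dom0 T : dom T 0.
Proof. by have [/[!inE]] := dom_submod T. Qed.

Lemma domP T (a : R[i]) u v : dom T u -> dom T v -> dom T (a *: u + v).
Proof.
by move=> Tu Tv; have [_ /(_ a u v)] := dom_submod T; rewrite !inE; apply.
Qed.

Lemma domZ T (a : R[i]) u : dom T u -> dom T (a *: u).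
Proof.
by move=> Tu; rewrite -(addr0 (a *: u)); apply: domP => //; exact: dom0.
Qed.

Lemma domD T u v : dom T u -> dom T v -> dom T (u + v).
Proof. by move=> Tu Tv; rewrite -(scale1r u); apply: domP. Qed.

Lemma domN T u : dom T u -> dom T (- u).
Proof. by rewrite -(@scaleN1r R[i]); exact: domZ. Qed.

Lemma operator0 T : T 0 = 0.
Proof.
have := operator_linear 1 (dom0 T) (dom0 T).
rewrite !scale1r addr0 => /eqP.
by rewrite -subr_eq0 opprD addNKr oppr_eq0 => /eqP.
Qed.

Lemma operatorZ T (a : R[i]) u : dom T u -> T (a *: u) = a *: T u.
Proof.
move=> Tu; rewrite -[a *: u]addr0 operator_linear //; last exact: dom0.
by rewrite operator0 addr0.
Qed.

Lemma operatorD T u v : dom T u -> dom T v -> T (u + v) = T u + T v.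
Proof.
by move=> Tu Tv; rewrite -[in LHS](scale1r u) operator_linear // scale1r.
Qed.

Lemma operatorN T u : dom T u -> T (- u) = - T u.
Proof. by move=> /(operatorZ (-1)); rewrite !scaleN1r. Qed.

Lemma closure_graph_linear T (a : R[i]) x x' y y' :
  closure (graph T) (x, y) -> closure (graph T) (x', y') ->
  closure (graph T) (a *: x + x', a *: y + y').
Proof.
move=> /closure_graphP xy /closure_graphP xy'; apply/closure_graphP => e e0.
pose c := complex.Re `|a|.
have c0 : 0 <= c by rewrite -lecR RRe_real // normr_ge0.
(* Stated for any space, since it serves in both [H] and [K]. The radius solves [c * d + d = e], and
   [c + 1] is positive even when [a = 0]. *)
have comb (V : hilbertType R) (p p' q q' : V) : hnorm (p - q) < e / (c + 1) ->
    hnorm (p' - q') < e / (c + 1) -> hnorm (a *: p + p' - (a *: q + q')) < e.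
  move=> pq pq'; rewrite opprD addrACA -scalerBr.
  apply: (le_lt_trans (ler_hnormD _ _)); rewrite hnormrZ -/c.
  have -> : e = c * (e / (c + 1)) + e / (c + 1) by field; lra.
  by rewrite ler_ltD // ler_wpM2l // ltW.
have d0 : 0 < e / (c + 1) by rewrite divr_gt0 //; lra.
have [g [Tg gx gy]] := xy _ d0; have [g' [Tg' gx' gy']] := xy' _ d0.
exists (a *: g + g'); split; [exact: domP|exact: comb|].
by rewrite operator_linear//; exact: comb.
Qed.

(** The closure of the graph is a linear relation, so two values over the same point differ by a
    value over [0]. If only [0] lies over [0], the relation is single-valued and choosing its values
    defines the closed extension. *)
Lemma closableP T :
  closable T <-> forall y, closure (graph T) (0, y) -> y = 0.
Proof.
split=> [[S TS] y|mul0].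
  by rewrite TS => -[x _ [-> <-]]; exact: operator0.
pose D := [set x | exists y, closure (graph T) (x, y)].
pose f x := xget 0 [set y | closure (graph T) (x, y)].
have fP x y : closure (graph T) (x, y) -> f x = y.
  move=> xy; apply: xget_unique => //= y' xy'; apply/eqP; rewrite -subr_eq0.
  apply/eqP/mul0; have := @closure_graph_linear T (-1) _ _ _ _ xy xy'.
  by rewrite !scaleN1r addNr addrC.
have Df x : D x -> closure (graph T) (x, f x).
  by case=> y xy; rewrite (fP _ _ xy).
have Dsub : GRing.submod_closed [in D].
  split=> [|a u v]; rewrite !inE.
    exists 0; apply: subset_closure.
    by exists 0; [exact: dom0|rewrite operator0].
  by move=> [y uy] [y' vy']; exists (a *: y + y'); exact: closure_graph_linear.
have flin (a : R[i]) u v : D u -> D v -> f (a *: u + v) = a *: f u + f v.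
  by move=> /Df uf /Df vf; apply/fP/closure_graph_linear.
exists (LinearOperator Dsub flin); apply/seteqP; split=> [[x y] xy|_ [x Dx <-]].
  by exists x => /=; [exists y|rewrite (fP _ _ xy)].
exact: Df.
Qed.

End OperatorTheory.

(** * Penalized approximation of [z] by values of [T] *)

Section Regularization.
Context {R : realType} {H K : hilbertType R} (T : linear_operator H K) (z : K).
Implicit Types (u v w : H) (n : nat).

Definition penalized n u : R := n.+1%:R * hnorm u ^+ 2 + hnorm (z - T u) ^+ 2.

Definition penalized_inf n : R := inf [set penalized n u | u in dom T].

(** The square matters: the variation argument divides by a step of order [1 / (n + 1)], and the
    error left must still tend to [0]. *)
Definition tolerance n : R := n.+1%:R^-1 ^+ 2.

Lemma penalized_ge0 n u : 0 <= penalized n u.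
Proof. by rewrite addr_ge0 ?mulr_ge0 ?exprn_ge0 ?hnorm_ge0. Qed.

Lemma penalized_has_inf n : has_inf [set penalized n u | u in dom T].
Proof.
split; first by exists (penalized n 0), 0 => //; exact: dom0.
by exists 0 => _ [u _ <-]; exact: penalized_ge0.
Qed.

Lemma penalized_inf_le n u : dom T u -> penalized_inf n <= penalized n u.
Proof.
by move=> Tu; apply: ge_inf; [case: (penalized_has_inf n)|exists u].
Qed.

Lemma penalized_inf_bound n : penalized_inf n <= hnorm z ^+ 2.
Proof.
apply: (le_trans (penalized_inf_le n (dom0 T))).
by rewrite /penalized operator0 subr0 hnormr0 expr0n mulr0 add0r.
Qed.

Lemma penalized_le n p u : (n <= p)%N -> penalized n u <= penalized p u.
Proof. by move=> np; rewrite lerD2r ler_wpM2r ?sqr_ge0 // ler_nat. Qed.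

Lemma penalized_inf_homo : {homo penalized_inf : n p / (n <= p)%N >-> n <= p}.
Proof.
move=> n p np; apply: lb_le_inf; first by case: (penalized_has_inf p).
move=> _ [u Tu <-]; apply: (le_trans (penalized_inf_le n Tu)).
exact: penalized_le.
Qed.

Lemma tolerance_gt0 n : 0 < tolerance n.
Proof. by rewrite exprn_gt0 // invr_gt0. Qed.

Lemma near_minimizer n :
  exists2 u, dom T u & penalized n u < penalized_inf n + tolerance n.
Proof.
have [_ [u Tu <-] ltu] := inf_adherent (tolerance_gt0 n) (penalized_has_inf n).
by exists u.
Qed.

(* The parallelogram law for the quadratic functional [penalized n], evaluated
   at the midpoint of two near minimizers. *)
Lemma near_minimizer_dist n p u v : (n <= p)%N -> dom T u -> dom T v ->
  penalized n u < penalized_inf n + tolerance n ->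
  penalized p v < penalized_inf p + tolerance p ->
  hnorm (T v - T u) ^+ 2 <=
    2 * (penalized_inf p - penalized_inf n + tolerance n + tolerance p).
Proof.
move=> np Tu Tv minu minv.
have Thalf : T ((2^-1)%:C%C *: (u + v)) = (2^-1)%:C%C *: (T u + T v).
  by rewrite operatorZ ?operatorD//; exact: domD.
have /(penalized_inf_le n) : dom T ((2^-1)%:C%C *: (u + v)).
  exact/domZ/domD.
have := penalized_le v np; move: minu minv; rewrite /penalized Thalf.
rewrite -!ipxx !ipE !ipxx
  (ipC v u) (ipC (T v) (T u)) (ipC (T u) z) (ipC (T v) z).
(* The parallelogram identity also produces this term, which is dropped by its sign. *)
have n0 : 0 <= n.+1%:R * hnorm (u - v) ^+ 2 by rewrite mulr_ge0 ?sqr_ge0.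
move: n0; rewrite -!ipxx !ipE !ipxx (ipC v u).
lra.
Qed.

(* Compare the near minimizer [u] with [u - t w], [t = 1 / (2 (n + 1))]. *)
Lemma near_minimizer_variation n u w : dom T u -> dom T w ->
  penalized n u < penalized_inf n + tolerance n ->
  - 2 * n.+1%:R^-1 - 2 * hnorm (T u) ^+ 2 <=
    hnorm w ^+ 2 - 2 * n.+1%:R * ip u w + 2 * ip z (T w) + hnorm (T w) ^+ 2.
Proof.
move=> Tu Tw minu; pose t : R := 2^-1 * n.+1%:R^-1.
pose a : R := n.+1%:R.
have a0 : 0 < a by rewrite ltr0n.
have {}minu := ltW minu.
have := penalized_inf_le n (domP (- t)%:C%C Tw Tu).
rewrite -(lerD2r (tolerance n)) => /(le_trans minu).
rewrite /penalized operator_linear// /tolerance -/a.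
(* This square absorbs the cross term [- 2 * ip (T u) (T w)] at the cost of
   [2 |T u|^2 + |T w|^2 / 2]; the other half of [|T w|^2] covers the second-order term, as
   [a^-1 <= 1]. *)
have := sqr_ge0 (hnorm (2%:C%C *: T u + T w)).
have := sqr_ge0 (hnorm w).
have a1 : a^-1 <= 1 by rewrite invf_le1 ?ler1n.
have : 0 <= (1 - a^-1) * hnorm (T w) ^+ 2.
  by rewrite mulr_ge0 ?sqr_ge0 // subr_ge0.
rewrite -!ipxx !ipE !ipxx.
rewrite (ipC (T u) z) (ipC (T w) z) (ipC w u) (ipC (T w) (T u)).
rewrite /t -/a => Tw0 w0 TuTw0.
(* Multiplying by [2 a = 1 / t] clears the step size from the first-order terms. *)
rewrite -subr_ge0 -(pmulr_rge0 _ (mulr_gt0 (ltr0n R 2) a0)).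
set D := (X in 0 <= X -> _).
have -> : D = 2 * ip z (T w) - 2 * a * ip u w + 2^-1 * hnorm w ^+ 2
    - 2 * ip (T u) (T w) + 2^-1 * a^-1 * hnorm (T w) ^+ 2 + 2 * a^-1.
  by rewrite /D; field; rewrite gt_eqF.
move: Tw0; rewrite mulrBl mul1r; move: (a^-1) => b Tw0.
lra.
Qed.

Lemma exists_small_near_minimizer e : closable T -> 0 < e ->
  exists n u, [/\ dom T u, penalized n u < penalized_inf n + tolerance n,
    (n.+1%:R^-1 : R) < e & hnorm (T u) ^+ 2 < e].
Proof.
move=> /closableP mul0 e0.
have /choice[s sP] : forall n, exists u,
    dom T u /\ penalized n u < penalized_inf n + tolerance n.
  by move=> n; have [u ? ?] := near_minimizer n; exists u.
have inv_lt (d : R) : 0 < d -> exists N, forall n, (N <= n)%N -> n.+1%:R^-1 < d.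
  move=> d0; have [N _ NP] := near_infty_natSinv_lt (PosNum d0).
  by exists N.
have tol_le n : tolerance n <= n.+1%:R^-1.
  by rewrite /tolerance expr2 ler_piMl ?invr_ge0 // invf_le1 ?ler1n.
have [y Ty] : exists y, forall d : R, 0 < d -> exists N, forall n, (N <= n)%N ->
    hnorm (T (s n) - y) < d.
  apply: hnorm_cauchy_cvg => d d0.
  have has_supm : has_sup (range penalized_inf).
    split; first by exists (penalized_inf 0), 0%N.
    by exists (hnorm z ^+ 2) => _ [n _ <-]; exact: penalized_inf_bound.
  (* In [near_minimizer_dist], the gap of the infima and both tolerances are each below [d^2 / 8],
     so the squared distance is below [6 d^2 / 8]. *)
  have d8 : 0 < d ^+ 2 / 8 by rewrite divr_gt0 // exprn_gt0.
  have [_ [M _ <-] ltM] := sup_adherent d8 has_supm.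
  have [N ltN] := inv_lt _ d8.
  exists (maxn M N) => n p; rewrite geq_max => /andP[Mn Nn] np.
  have [Tn minsn] := sP n; have [Tp minp] := sP p.
  rewrite -(@ltr_pXn2r _ 2) ?nnegrE ?hnorm_ge0 ?ltW //.
  apply: (le_lt_trans (near_minimizer_dist np Tn Tp minsn minp)).
  have := le_lt_trans (tol_le n) (ltN n Nn).
  have := le_lt_trans (tol_le p) (ltN p (leq_trans Nn np)).
  have := penalized_inf_homo Mn.
  have : penalized_inf p <= sup (range penalized_inf).
    by apply: ub_le_sup; [case: has_supm|exists p].
  lra.
have y0 : y = 0.
  apply/mul0/closure_graphP => d d0.
  have [N TN] := Ty _ d0.
  (* Since the infimum is at most [|z|^2] and the tolerance at most [1], the penalty
     [(n + 1) |s n|^2] stays below [|z|^2 + 1]; this forces [s n] to [0]. *)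
  have C0 : 0 < d ^+ 2 / (hnorm z ^+ 2 + 1).
    by rewrite divr_gt0 ?exprn_gt0 // ltr_wpDl ?sqr_ge0.
  have [M ltM] := inv_lt _ C0.
  pose n := maxn M N; exists (s n); have [Tn minsn] := sP n.
  split => //; last by apply: TN; exact: leq_maxr.
  rewrite subr0 -(@ltr_pXn2r _ 2) ?nnegrE ?hnorm_ge0 ?ltW //.
  have := ltM n (leq_maxl _ _).
  rewrite invf_plt ?posrE // ?invf_div => ltn.
  have n1 : n.+1%:R * hnorm (s n) ^+ 2 < hnorm z ^+ 2 + 1.
    apply: le_lt_trans (lt_le_trans minsn _); first by rewrite lerDl sqr_ge0.
    apply: lerD; first exact: penalized_inf_bound.
    by rewrite (le_trans (tol_le n)) // invf_le1 ?ler1n.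
  rewrite -(ltr_pM2l (ltr0Sn R n)); apply: (lt_trans n1).
  by rewrite -ltr_pdivrMr ?exprn_gt0.
have se0 : 0 < Num.sqrt e by rewrite sqrtr_gt0.
have [N TN] := Ty _ se0; have [M ltM] := inv_lt _ e0.
exists (maxn M N), (s (maxn M N)); have [Tn minsn] := sP (maxn M N).
split => //; first by apply: ltM; exact: leq_maxl.
have := TN _ (leq_maxr M N); rewrite y0 subr0.
rewrite -(@ltr_pXn2r _ 2) ?nnegrE ?hnorm_ge0 ?ltW //.
by rewrite sqr_sqrtr // ltW.
Qed.

End Regularization.

(** * The sup-inf formula *)

Section SupInf.
Context {R : realType} {H K : hilbertType R} (T : linear_operator H K).

Definition excess (phi h g : H) : R :=
  hnorm (g + h) ^+ 2 - hnorm (phi + h) ^+ 2 + hnorm (T g) ^+ 2.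

Definition supinf (phi : H) : \bar R :=
  ereal_sup [set ereal_inf [set (excess phi h g)%:E | g in dom T]
            | h in dom T].

Lemma supinf_le phi : dom T phi -> (supinf phi <= (hnorm (T phi) ^+ 2)%:E)%E.
Proof.
move=> Tphi; apply: ge_ereal_sup => _ [h Th <-]; apply: ge_ereal_inf.
exists (hnorm (T phi) ^+ 2)%:E => //; exists phi => //.
by rewrite /excess subrr add0r.
Qed.

(** Trades extended reals for an epsilon form in which a single [h] serves all [g]. *)
Lemma le_supinfP phi :
  ((hnorm (T phi) ^+ 2)%:E <= supinf phi)%E <->
  forall e : R, 0 < e -> exists2 h, dom T h & forall g, dom T g ->
    hnorm (T phi) ^+ 2 - e <= excess phi h g.
Proof.
split=> [le_sup e e0|approx].
  have /ereal_sup_gt[_ [h Th <-] /ltW lth] :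
      ((hnorm (T phi) ^+ 2 - e)%:E < supinf phi)%E.
    by apply: lt_le_trans le_sup; rewrite lte_fin ltrBlDr ltrDl.
  exists h => // g Tg; rewrite -lee_fin; apply: (le_trans lth).
  by apply: ereal_inf_lbound; exists g.
apply/lee_subgt0Pr => e e0; have [h Th hP] := approx e e0.
apply: le_ereal_sup_tmp.
exists (ereal_inf [set (excess phi h g)%:E | g in dom T]).
  by exists h.
by apply: le_ereal_inf_tmp => _ [g Tg <-]; rewrite -EFinB lee_fin hP.
Qed.

Lemma closable_le_supinf phi : closable T -> dom T phi ->
  ((hnorm (T phi) ^+ 2)%:E <= supinf phi)%E.
Proof.
move=> Tcl Tphi; apply/le_supinfP => e e0.
have e4 : 0 < e / 4 by rewrite divr_gt0.
have [n [u [Tu minu ne Tue]]] := exists_small_near_minimizer (T phi) Tcl e4.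
(* With [w = g - phi] and [a = n + 1], this [h] gives [g + h = w - a u] and [phi + h = - a u]. Hence
   the excess minus [|T phi|^2] is exactly the right-hand side of [near_minimizer_variation] for
   [z = T phi], and the loss [2 / a + 2 |T u|^2] is below [e]. *)
exists (- (n.+1%:R%:C%C *: u + phi)); first by apply: domN; exact: domP.
move=> g Tg; rewrite /excess.
have Tw : dom T (g - phi) by apply: domD => //; exact: domN.
have := near_minimizer_variation Tu Tw minu.
have -> : T (g - phi) = T g - T phi.
  by rewrite operatorD ?operatorN //; exact: domN.
rewrite -!ipxx !ipE !ipxx (ipC (T g) (T phi)) (ipC g phi) (ipC g u) (ipC phi u).
move: (n.+1%:R^-1 : R) ne => b be; lra.
Qed.

(* Test the near-supremum on [g = phi - u] with [u] tending to [0] and [T u]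
   to [y]: the contributions of [h] cancel in the limit. *)
Lemma le_supinf_mul phi y : dom T phi -> closure (graph T) (0, y) ->
  ((hnorm (T phi) ^+ 2)%:E <= supinf phi)%E ->
  hnorm (T phi) <= hnorm (T phi - y).
Proof.
move=> Tphi /closure_graphP mulTy /le_supinfP approx.
rewrite -(@ler_pXn2r _ 2) ?nnegrE ?hnorm_ge0 //; apply/ler_addgt0Pr => e e0.
have [|h Th hP] := approx (e / 2); first by rewrite divr_gt0.
pose A := hnorm (phi + h); pose B := hnorm (T phi - y).
have A0 : 0 <= A by exact: hnorm_ge0.
have B0 : 0 <= B by exact: hnorm_ge0.
(* The error is [2 d (A + B) + 2 d^2]. Since [d <= 1], it is at most [2 d (A + B + 1) <= e / 2]; the
   other [e / 2] is the slack of [h]. *)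
pose d := Num.min 1 (e / (4 * (A + B + 1))).
have d0 : 0 < d by rewrite lt_min ltr01 divr_gt0 //; lra.
have [u [Tu u0 uy]] := mulTy d d0.
have TNu := domN Tu.
have := hP _ (domD TNu Tphi).
rewrite /excess operatorD // operatorN //.
have gA : hnorm (- u + phi + h) <= A + d.
  rewrite -addrA addrC; apply: le_trans (ler_hnormD _ _) _.
  by rewrite hnormrN lerD2l ltW // -[u]subr0.
have TgB : hnorm (- T u + T phi) <= B + d.
  have -> : - T u + T phi = (T phi - y) - (T u - y).
    by rewrite opprB addrA subrK addrC.
  by apply: le_trans (ler_hnormD _ _) _; rewrite hnormrN lerD2l ltW.
have {}gA : hnorm (- u + phi + h) ^+ 2 <= (A + d) ^+ 2.
  by rewrite ler_pXn2r ?nnegrE ?hnorm_ge0 // addr_ge0 // ltW.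
have {}TgB : hnorm (- T u + T phi) ^+ 2 <= (B + d) ^+ 2.
  by rewrite ler_pXn2r ?nnegrE ?hnorm_ge0 // addr_ge0 // ltW.
have d1 : d * d <= d by rewrite ler_piMl ?(ltW d0) // /d ge_min lexx.
have dAB : d * (4 * (A + B + 1)) <= e.
  by rewrite -ler_pdivlMr; [rewrite /d ge_min lexx orbT|lra].
rewrite -/A -/B; lra.
Qed.

End SupInf.

Theorem theorem5p4 (R : realType) (H K : hilbertType R)
    (T : linear_operator H K) :
  closable T <->
  (forall phi : H, dom T phi ->
     (hnorm (T phi) ^+ 2)%:E =
     ereal_sup [set ereal_inf [set (hnorm (g + h) ^+ 2
                                    - hnorm (phi + h) ^+ 2
                                    + hnorm (T g) ^+ 2)%:E
                              | g in dom T]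
               | h in dom T]).
Proof.
split=> [Tcl phi Tphi|supinfE].
  by apply/le_anti/andP; split; [exact: closable_le_supinf|exact: supinf_le].
apply/closableP => y mulTy; apply: hnorm0_eq0; apply/le_anti/andP.
split; last exact: hnorm_ge0.
apply/ler_addgt0Pr => e e0; rewrite add0r.
(* Applying [le_supinf_mul] at [g] itself gives [|y| <= |T g| + |T g - y| <= 2 |T g - y| < e]. *)
have [|g [Tg _ gy]] := (closure_graphP _ _ _).1 mulTy (e / 2).
  by rewrite divr_gt0.
have Tgle : hnorm (T g) <= hnorm (T g - y).
  by apply: le_supinf_mul => //; rewrite (supinfE g Tg).
have -> : y = T g - (T g - y) by rewrite subKr.
apply: le_trans (ler_hnormD _ _) _; rewrite hnormrN; lra.
Qed.
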